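(* Let $G$ be a graph of order $n \geq 2$ with no isolated vertex. Then $$\tilde{\gamma}_{c}(M(G)) \geq \rho(G).$$
   Context: All graphs are non-empty, finite, undirected and simple. The order of a graph is its number of vertices. A dominating set of a graph $H$ is a set $S \subseteq V(H)$ such that $N_H[v] \cap S \neq \emptyset$ for every $v \in V(H)$, where $N_H[v]$ is the closed neighborhood of $v$. A dominating set $S$ of $H$ is an outer-connected dominating set if the graph $H - S$ (obtained by deleting the vertices in $S$) is connected. The outer-connected domination number $\tilde{\gamma}_c(H)$ is the minimum cardinality of an outer-connected dominating set of $H$. The middle graph $M(G)$ of a graph $G$ is the graph with vertex set $V(G) \cup E(G)$ (disjoint union), in which two vertices $x,y$ are adjacent if and only if either $x,y \in E(G)$ are distinct edges sharing an endpoint in $G$, or one of them is a vertex of $G$ and the other is an edge of $G$ incident with it. The edge cover number $\rho(G)$ is the minimum cardinality of an edge cover of $G$, i.e. of a set of edges such that every vertex of $G$ is incident with at least one of them. *)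

(* Defs.v *)
From mathcomp Require Import all_boot.

Set Implicit Arguments.
Unset Strict Implicit.
Unset Printing Implicit Defensive.

Record sgraph := SGraph {
  svertex :> finType;
  adj : rel svertex;
  adj_sym : symmetric adj;
  adj_irr : irreflexive adj }.

Section Graphs.
Variable G : sgraph.
Implicit Types (x y v : G) (S : {set G}).

Definition edge_set : {set {set G}} :=
  [set [set p.1; p.2] | p : G * G & adj p.1 p.2].

Definition edge : finType := {e : {set G} | e \in edge_set}.

Definition incident v (e : edge) : bool := v \in val e.

Definition no_isolated : bool := [forall v : G, [exists u : G, adj v u]].

Definition closed_nbhd v : {set G} := [set u : G | (u == v) || adj v u].

Definition dominating S : bool := [forall v : G, closed_nbhd v :&: S != set0].

(* Graphs are non-empty by convention, so the graph without vertices is not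
   connected. *)
Definition connected : bool :=
  (0 < #|G|) && [forall x : G, [forall y : G, connect (@adj G) x y]].

Definition del_adj S : rel {x : G | x \notin S} :=
  relpre val (@adj G).

Lemma del_adj_sym S : symmetric (@del_adj S).
Proof. by move=> x y; rewrite /del_adj /= adj_sym. Qed.

Lemma del_adj_irr S : irreflexive (@del_adj S).
Proof. by move=> x; rewrite /del_adj /= adj_irr. Qed.

Definition del_vertices S : sgraph := SGraph (@del_adj_sym S) (@del_adj_irr S).

Definition middle_adj : rel (G + edge)%type := fun a b =>
  match a, b with
  | inl _, inl _ => false
  | inl v, inr e => incident v e
  | inr e, inl v => incident v e
  | inr e, inr f => (e != f) && [exists v : G, incident v e && incident v f]
  end.

Lemma middle_adj_sym : symmetric middle_adj.
Proof.
move=> [v|e] [w|f] //=; rewrite eq_sym; congr (_ && _).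
by apply: eq_existsb => v; rewrite andbC.
Qed.

Lemma middle_adj_irr : irreflexive middle_adj.
Proof. by move=> [v|e] //=; rewrite eqxx. Qed.

Definition middle_graph : sgraph := SGraph middle_adj_sym middle_adj_irr.

Definition edge_cover (C : {set edge}) : bool :=
  [forall v : G, [exists e in C, incident v e]].

End Graphs.

Definition outer_connected_dominating (H : sgraph) (S : {set H}) : bool :=
  dominating S && connected (del_vertices S).

(* The initial value #|T| bounds the cardinality of every subset of T, so it
   never affects the minimum when some set satisfies P. *)
Definition min_card (T : finType) (P : pred {set T}) : nat :=
  \big[minn/#|T|]_(A : {set T} | P A) #|A|.

Definition oc_domination_number (H : sgraph) : nat :=
  min_card (@outer_connected_dominating H).

Definition edge_cover_number (G : sgraph) : nat := min_card (@edge_cover G).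

Lemma min_card_le (T : finType) (P : pred {set T}) (A : {set T}) :
  P A -> min_card P <= #|A|.
Proof.
move=> PA; rewrite /min_card; have := mem_index_enum A.
elim: (index_enum _) => //= B s IHs; rewrite inE big_cons.
case/predU1P=> [<-|/IHs le_sA]; first by rewrite PA geq_minl.
by case: ifP => // _; exact: leq_trans (geq_minr _ _) le_sA.
Qed.

Lemma min_card_attained (T : finType) (P : pred {set T}) (A0 : {set T}) :
  P A0 -> exists2 A, P A & min_card P = #|A|.
Proof.
move=> PA0; case: (arg_minnP (fun A : {set T} => #|A|) PA0) => A PA minA.
exists A => //; apply/eqP; rewrite eqn_leq min_card_le //=.
rewrite /min_card; elim/big_ind: _ => [|m n lem len|B PB].
- exact: max_card.
- by rewrite leq_min lem len.
- exact: minA.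
Qed.

(* If G is non-empty and has no isolated vertex, both families minimized over
   are non-empty. *)
Lemma edge_cover_setT (G : sgraph) : no_isolated G -> edge_cover [set: edge G].
Proof.
move=> /forallP niG; apply/forallP => v; have /existsP[u vu] := niG v.
have eE : [set v; u] \in edge_set G by apply/imsetP; exists (v, u); rewrite ?inE.
apply/existsP; exists (exist (fun e => e \in edge_set G) _ eE); apply/andP; split; first exact: in_setT.
exact: set21.
Qed.

Lemma oc_dominating_setC1 (H : sgraph) (x y : H) :
  adj x y -> outer_connected_dominating (~: [set x]).
Proof.
move=> xy; have yx : y != x by apply: contraTneq xy => ->; rewrite adj_irr.
apply/andP; split.
  apply/forallP => v; apply/set0Pn.
  have [->|vx] := eqVneq v x; first by exists y; rewrite !inE xy orbT.
  by exists v; rewrite !inE eqxx.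
have xS : x \notin ~: [set x] by rewrite !inE eqxx.
apply/andP; split; first by apply/card_gt0P; exists (exist (fun z => z \notin ~: [set x]) x xS).
apply/forallP => a; apply/forallP => b.
suff -> : a = b by exact: connect0.
apply: val_inj; case: a b => [a aS] [b bS] /=.
by move: aS bS; rewrite !inE !negbK => /eqP-> /eqP->.
Qed.

Lemma middle_oc_dominating (G : sgraph) :
  0 < #|G| -> no_isolated G ->
  exists S : {set middle_graph G}, outer_connected_dominating S.
Proof.
move=> /card_gt0P[v _] /edge_cover_setT/forallP/(_ v)/existsP[e /andP[_ ve]].
exists (~: [set (inl v : middle_graph G)]).
exact: (@oc_dominating_setC1 (middle_graph G) (inl v) (inr e)).
Qed.

(* Main.v *)
Require Import Defs.
From mathcomp Require Import all_boot.

(** The bound comes from domination.  In the middle graph the neighbors of an original vertex v are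
    exactly the edges of G incident with v, so a dominating set contains v
    itself or an edge at v.  Keeping the edges of the dominating set and
    replacing each of its original vertices by an edge at that vertex
    ([edge_cover_imset]) therefore gives an edge cover of G, and taking an
    image does not increase cardinality. *)

Lemma incident_choice (G : sgraph) :
  no_isolated G -> exists f : G -> edge G, forall v, incident v (f v).
Proof.
move=> niG; apply: (@fin_all_exists _ (fun=> edge G) (fun v e => incident v e)) => v.
have /forallP/(_ v)/existsP[e /andP[_ ve]] := edge_cover_setT niG.
by exists e.
Qed.

(** The choice [f] of an edge at every vertex turns each member of the middle
    graph into a single edge of G, so that the edge cover is an image of [S]
    and its size is bounded by that of [S]. *)
Lemma edge_cover_imset (G : sgraph) (f : G -> edge G)
    (S : {set middle_graph G}) :
    (forall v, incident v (f v)) -> dominating S ->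
  edge_cover [set match x with inl v => f v | inr e => e end | x in S].
Proof.
move=> fP /forallP domS; apply/forallP => v.
have /set0Pn[x] := domS (inl v : middle_graph G).
rewrite !inE => /andP[vx xS]; apply/existsP.
exists (match x with inl w => f w | inr e => e end); apply/andP; split.
  by apply/imsetP; exists x.
by case: x vx {xS} => [w|e] /orP[/eqP|] //= [->].
Qed.

Lemma edge_cover_number_le_dominating (G : sgraph) (S : {set middle_graph G}) :
  no_isolated G -> dominating S -> edge_cover_number G <= #|S|.
Proof.
move=> niG domS; have [f fP] := incident_choice G niG.
exact: leq_trans (min_card_le (edge_cover_imset G f S fP domS)) (leq_imset_card _ _).
Qed.

Theorem corollary4p2 (G : sgraph) (n : nat) (order_G : #|G| = n)
    (n_ge2 : 2 <= n) (niG : no_isolated G) :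
  oc_domination_number (middle_graph G) >= edge_cover_number G.
Proof.
have G_gt0 : 0 < #|G| by rewrite order_G ltnW.
(* The minimum is the size of an outer-connected dominating set, rather than
   the default value of its definition, only because such a set exists. *)
have [S0 ocS0] := middle_oc_dominating G_gt0 niG.
have [S /andP[domS _] ocE] := min_card_attained ocS0.
by rewrite /oc_domination_number ocE edge_cover_number_le_dominating.
Qed.
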